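(* For $i=1,2$ let $\mathfrak l_i$ be an abelian Lie algebra, $(\mathfrak a_i,\omega_{\mathfrak a_i})$ a symplectic Lie algebra and $(\gamma_i,\epsilon_i,\xi_i)\in Z^2(\mathfrak l_i,\mathfrak a_i,\omega_{\mathfrak a_i})_\sharp$. The symplectic Lie algebras $\mathfrak d_{\gamma_1,\epsilon_1,\xi_1}(\mathfrak l_1,\mathfrak a_1)$ and $\mathfrak d_{\gamma_2,\epsilon_2,\xi_2}(\mathfrak l_2,\mathfrak a_2)$ are isomorphic if and only if there are an isomorphism $S:\mathfrak l_1\to\mathfrak l_2$ of vector spaces and an isomorphism $U:(\mathfrak a_2,\omega_{\mathfrak a_2})\to(\mathfrak a_1,\omega_{\mathfrak a_1})$ of symplectic Lie algebras such that $$(S,U)^*[\gamma_2,\epsilon_2,\xi_2]=[\gamma_1,\epsilon_1,\xi_1]\in H^2(\mathfrak l_1,\mathfrak a_1,\omega_{\mathfrak a_1}).$$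
   Context: All vector spaces and Lie algebras are real and finite-dimensional. A symplectic Lie algebra $(\mathfrak g,\omega)$ is a Lie algebra $\mathfrak g$ with a skew-symmetric non-degenerate bilinear form $\omega$ such that $\omega([X,Y],Z)+\omega([Y,Z],X)+\omega([Z,X],Y)=0$ for all $X,Y,Z$. An isomorphism of symplectic Lie algebras is a Lie algebra isomorphism $\varphi$ with $\varphi^*\omega_2=\omega_1$. Let $\mathfrak l$ be abelian and $(\mathfrak a,\omega_{\mathfrak a})$ symplectic. Let $\gamma:\mathfrak l\to\operatorname{Hom}(\mathfrak a,\mathfrak l^* )$ and $\xi:\mathfrak l\to\operatorname{Hom}(\mathfrak a,\mathfrak a)$ be linear and $\epsilon:\mathfrak l\times\mathfrak l\to\mathfrak l^*$ alternating bilinear. Write $\gamma(L_1,A,L_2):=(\gamma(L_1)(A))(L_2)$. Define alternating bilinear maps $\alpha:\mathfrak l\times\mathfrak l\to\mathfrak a$, $\beta:\mathfrak a\times\mathfrak a\to\mathfrak l^*$ by $$\omega_{\mathfrak a}(\alpha(L_1,L_2),A)=\gamma(L_1,A,L_2)-\gamma(L_2,A,L_1),\qquad \beta(A_1,A_2)(L)=-\omega_{\mathfrak a}(\xi(L)A_1,A_2)-\omega_{\mathfrak a}(A_1,\xi(L)A_2).$$ $Z^2(\mathfrak l,\mathfrak a,\omega_{\mathfrak a})$ is the set of such triples with, for all $L,L_i\in\mathfrak l$, $A,A_i\in\mathfrak a$: (1) every $\xi(L)$ is a derivation of $\mathfrak a$, $\xi(L_1)\xi(L_2)-\xi(L_2)\xi(L_1)=\operatorname{ad}_{\mathfrak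 a}(\alpha(L_1,L_2))$, and $\xi(L_1)\alpha(L_2,L_3)+\xi(L_2)\alpha(L_3,L_1)+\xi(L_3)\alpha(L_1,L_2)=0$; (2) $\beta(\xi(L)A_1,A_2)+\beta(A_1,\xi(L)A_2)=\gamma(L)[A_1,A_2]_{\mathfrak a}$; (3) $\gamma(L_2)(\xi(L_1)A)-\gamma(L_1)(\xi(L_2)A)+\beta(\alpha(L_1,L_2),A)=0$; (4) $\gamma(L_1)\alpha(L_2,L_3)+\gamma(L_2)\alpha(L_3,L_1)+\gamma(L_3)\alpha(L_1,L_2)=0$; (5) $\epsilon(L_1,L_2)L_3+\epsilon(L_2,L_3)L_1+\epsilon(L_3,L_1)L_2=0$. For $(\gamma,\epsilon,\xi)\in Z^2(\mathfrak l,\mathfrak a,\omega_{\mathfrak a})$, $\mathfrak d_{\gamma,\epsilon,\xi}(\mathfrak l,\mathfrak a)$ is the symplectic Lie algebra $\mathfrak l^*\oplus\mathfrak a\oplus\mathfrak l$ with brackets $[\mathfrak l^*,\cdot]=0$, $[A_1,A_2]=\beta(A_1,A_2)+[A_1,A_2]_{\mathfrak a}$, $[L,A]=\gamma(L)A+\xi(L)A$, $[L_1,L_2]=\epsilon(L_1,L_2)+\alpha(L_1,L_2)$ and form $\omega(Z_1+A_1+L_1,Z_2+A_2+L_2)=Z_1(L_2)+\omega_{\mathfrak a}(A_1,A_2)-Z_2(L_1)$. $Z^2(\mathfrak l,\mathfrak a,\omega_{\mathfrak a})_\sharp$ is the set of $(\gamma,\epsilon,\xi)\in Z^2(\mathfrak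 l,\mathfrak a,\omega_{\mathfrak a})$ such that (a) $L=0$ is the only $L\in\mathfrak l$ for which there is an $A\in\mathfrak a$ satisfying simultaneously $\operatorname{ad}_{\mathfrak a}(A)+\xi(L)=0$, $\gamma(L)+\beta(A,\cdot)=0$, $\alpha(L,L')=\xi(L')A$ and $\epsilon(L,L')=\gamma(L')A$ for all $L'\in\mathfrak l$; (b) the subspace $\{A\in\mathfrak z(\mathfrak a): \beta(A,\cdot)=0,\ \xi(L)A=0,\ \gamma(L)A=0\ \forall L\in\mathfrak l\}$ of $\mathfrak a$ is non-degenerate with respect to $\omega_{\mathfrak a}$ (the zero subspace counts as non-degenerate). The additive group $C^1(\mathfrak l,\mathfrak a)=\operatorname{Hom}(\mathfrak l,\mathfrak a)$ acts on triples by $(\gamma,\epsilon,\xi)\tau=(\gamma',\epsilon',\xi')$, where, with $\tau^*:\mathfrak a\to\mathfrak l^*$, $\tau^*(A)(L)=\omega_{\mathfrak a}(\tau L,A)$, $\xi'(L)A=\xi(L)A-[\tau L,A]_{\mathfrak a}$, $\gamma'(L)A=\gamma(L)A+\tau^*(\xi(L)A)-\tau^*([\tau L,A]_{\mathfrak a})-\beta(\tau L,A)$, $\epsilon'(L_1,L_2)=\epsilon(L_1,L_2)+\tau^*(\alpha(L_1,L_2))-\gamma(L_1)(\tau L_2)+\gamma(L_2)(\tau L_1)-\tau^*(\xi(L_1)\tau L_2-\xi(L_2)\tau L_1)+\tau^*([\tau L_1,\tau L_2]_{\mathfrak a})+\beta(\tau L_1,\tau L_2)$. This action preserves $Z^2(\mathfrak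 l,\mathfrak a,\omega_{\mathfrak a})$; the orbit space is $H^2(\mathfrak l,\mathfrak a,\omega_{\mathfrak a})$, and $[\gamma,\epsilon,\xi]$ is the class of $(\gamma,\epsilon,\xi)$. For a vector space isomorphism $S:\mathfrak l_1\to\mathfrak l_2$ and an isomorphism of symplectic Lie algebras $U:\mathfrak a_2\to\mathfrak a_1$, the pull back $(S,U)^*(\gamma,\epsilon,\xi)=(\gamma'',\epsilon'',\xi'')$ of $(\gamma,\epsilon,\xi)\in Z^2(\mathfrak l_2,\mathfrak a_2,\omega_{\mathfrak a_2})$ is given by $\gamma''(L)A=S^*(\gamma(SL)(U^{-1}A))$, $\epsilon''(L_1,L_2)=S^*(\epsilon(SL_1,SL_2))$, $\xi''(L)A=U\xi(SL)U^{-1}A$, where $S^*:\mathfrak l_2^*\to\mathfrak l_1^*$ is the transpose of $S$. It maps $Z^2(\mathfrak l_2,\mathfrak a_2,\omega_{\mathfrak a_2})$ to $Z^2(\mathfrak l_1,\mathfrak a_1,\omega_{\mathfrak a_1})$ and induces $(S,U)^*[\gamma,\epsilon,\xi]=[(S,U)^*(\gamma,\epsilon,\xi)]$. *)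

(* Defs.v *)
(* R : realType is the field of real numbers, and vector spaces are
   finite-dimensional (vectType R). *)
From HB Require Import structures.
From mathcomp Require Import all_boot all_order all_algebra.
From mathcomp Require Import classical_sets reals.
From mathcomp Require Import ring lra.
Set Implicit Arguments.
Unset Strict Implicit.
Unset Printing Implicit Defensive.
Import Order.TTheory GRing.Theory Num.Theory.
Local Open Scope ring_scope.

(* ['Hom(U, V)] packed as a vectType. In ['Hom(U, 'Hom(V, W))] the inner space
   would be inferred as a semiVectType that does not come from a vectType, and
   rewriting in nested applications then becomes very slow. *)
Definition Lin (R : realType) (U V : vectType R) : vectType R := 'Hom(U, V).
Definition dual (R : realType) (V : vectType R) : vectType R := Lin V R^o.

(* [linfun f] and [bilin f] are meaningful only for (bi)linear [f]; every use
   below comes with a lemma giving its values. *)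
Lemma linfun_val (R : realType) (U V : vectType R) (f : U -> V)
    (fL : linear f) x : linfun f x = f x.
Proof.
pose H := GRing.isLinear.Build R U V _ f fL.
pose F : {linear U -> V} := HB.pack f H.
exact: (lfunE F).
Qed.

Section Bilin.
Variables (R : realType) (U V W : vectType R).

Definition bilin (f : U -> V -> W) : Lin U (Lin V W) :=
  linfun (fun u => linfun (f u)).

Lemma bilinE (f : U -> V -> W) :
  (forall v, linear (f ^~ v)) -> (forall u, linear (f u)) ->
  forall u v, bilin f u v = f u v.
Proof.
move=> fl fr u v; have fL : linear (fun u => linfun (f u)).
  move=> k x y; apply/lfunP=> z.
  by rewrite add_lfunE scale_lfunE !linfun_val // fl.
by rewrite /bilin (linfun_val fL) linfun_val.
Qed.
End Bilin.

Record lieAlg (R : realType) := LieAlg {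
  lie_vect :> vectType R;
  bracket : Lin lie_vect (Lin lie_vect lie_vect);
  bracketxx : forall x, bracket x x = 0;
  jacobi : forall x y z, bracket x (bracket y z) + bracket y (bracket z x)
                         + bracket z (bracket x y) = 0 }.
Arguments bracket {R l}.

Definition lie_abelian (R : realType) (g : lieAlg R) : Prop :=
  forall x y : g, bracket x y = 0.

Definition derivation (R : realType) (g : lieAlg R) (D : Lin g g) : Prop :=
  forall x y : g, D (bracket x y) = bracket (D x) y + bracket x (D y).

Record symplLie (R : realType) := SymplLie {
  sympl_lie :> lieAlg R;
  omega : Lin sympl_lie (dual sympl_lie);
  omega_skew : forall x y, omega x y = - omega y x;
  omega_nondeg : forall x, (forall y, omega x y = 0) -> x = 0;
  omega_closed : forall x y z : sympl_lie,
    omega (bracket x y) z + omega (bracket y z) x + omega (bracket z x) y = 0 }.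
Arguments omega {R s}.

Definition sympl_iso (R : realType) (g h : symplLie R) (phi : Lin g h) :=
  [/\ bijective phi,
      forall x y, phi (bracket x y) = bracket (phi x) (phi y)
    & forall x y, omega (phi x) (phi y) = omega x y].

Definition sympl_isomorphic (R : realType) (g h : symplLie R) : Prop :=
  exists phi : Lin g h, sympl_iso phi.

Section Sharp.
Variables (R : realType) (a : symplLie R).

(* The vector representing a linear form via omega. *)
Definition sharp : Lin (dual a) a := (@omega R a)^-1%VF.

Lemma omega_sharp (f : dual a) (A : a) : omega (sharp f) A = f A.
Proof.
have k0 : lker (@omega R a) == 0%VS.
  apply/lker0P => x y exy; apply/eqP; rewrite -subr_eq0; apply/eqP.
  by apply: omega_nondeg => z; rewrite linearB /= exy subrr zero_lfunE.
suff fin : f \in limg (@omega R a) by rewrite /sharp (limg_lfunVK fin).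
suff -> : limg (@omega R a) = fullv by exact: memvf.
apply/eqP; rewrite eqEdim subvf limg_dim_eq; last first.
  by rewrite (eqP k0) capv0.
by rewrite !dimvf /dim /= muln1.
Qed.

Lemma omega_inj (x y : a) : (forall z, omega x z = omega y z) -> x = y.
Proof.
move=> e; apply/eqP; rewrite -subr_eq0; apply/eqP; apply: omega_nondeg => z.
by rewrite linearB /= add_lfunE opp_lfunE e subrr.
Qed.
End Sharp.
Arguments sharp {R a}.

Lemma scale_reg (R : realType) (k : R) (x : R^o) : k *: x = k * x :> R.
Proof. by []. Qed.

Section LfunMorph.
Variables (R : realType) (U V : vectType R) (f : Lin U V).
Lemma lfunD x y : f (x + y) = f x + f y. Proof. exact: linearD. Qed.
Lemma lfunN x : f (- x) = - f x. Proof. exact: linearN. Qed.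
Lemma lfunZ k x : f (k *: x) = k *: f x. Proof. exact: linearZ. Qed.
Lemma lfun0 : f 0 = 0. Proof. exact: linear0. Qed.
End LfunMorph.

(* Instances of [linear0], [linearD], ... for lfuns: rewriting with the generic
   lemmas is too slow on nested applications. *)
Definition lfunX := (add_lfunE, opp_lfunE, scale_lfunE, comp_lfunE, zero_lfunE,
  lfunD, lfunN, lfunZ, lfun0).
Ltac lexp := repeat progress
  rewrite ?lfunD ?lfunN ?lfunZ ?lfun0 ?comp_lfunE
    ?add_lfunE ?opp_lfunE ?scale_lfunE ?zero_lfunE; rewrite ?scale_reg.

Lemma bracketC (R : realType) (g : lieAlg R) (x y : g) :
  bracket x y = - bracket y x.
Proof.
apply/eqP; rewrite -addr_eq0; apply/eqP; have := bracketxx (x + y).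
by rewrite !lfunX !bracketxx add0r addr0 addrC.
Qed.

Lemma triple_eq (T1 T2 T3 : Type) (x y : T1 * T2 * T3) :
  x.1.1 = y.1.1 -> x.1.2 = y.1.2 -> x.2 = y.2 -> x = y.
Proof. by case: x y => [[? ?] ?] [[? ?] ?] /= -> -> ->. Qed.

Section Cochains.
Variables (R : realType) (l : vectType R) (a : symplLie R).

(* Triples; that epsilon is alternating is part of [Z2]. *)
Record triple := Triple {
  gamma : Lin l (Lin a (dual l));
  epsilon : Lin l (Lin l (dual l));
  xi : Lin l (Lin a a) }.

Variable t : triple.

Definition alpha : Lin l (Lin l a) :=
  bilin (fun L1 L2 =>
    sharp (linfun (fun A : a => gamma t L1 A L2 - gamma t L2 A L1))).

Definition beta : Lin a (Lin a (dual l)) :=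
  bilin (fun A1 A2 =>
    linfun (fun L => - omega (xi t L A1) A2 - omega A1 (xi t L A2))).

Lemma betaE A1 A2 L :
  beta A1 A2 L = - omega (xi t L A1) A2 - omega A1 (xi t L A2).
Proof.
have fL B1 B2 :
    linear (fun L => - omega (xi t L B1) B2 - omega B1 (xi t L B2) : R^o).
  by move=> k x y; lexp; ring.
rewrite /beta bilinE ?(linfun_val (fL _ _)) // => [v|u] k x y; apply/lfunP => z.
  by rewrite (linfun_val (fL _ _)); lexp; rewrite !(linfun_val (fL _ _)); ring.
by rewrite (linfun_val (fL _ _)); lexp; rewrite !(linfun_val (fL _ _)); ring.
Qed.

Lemma alphaE L1 L2 A :
  omega (alpha L1 L2) A = gamma t L1 A L2 - gamma t L2 A L1.
Proof.
have fL M1 M2 : linear (fun A => gamma t M1 A M2 - gamma t M2 A M1 : R^o).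
  by move=> k x y; lexp; ring.
rewrite /alpha bilinE ?omega_sharp ?(linfun_val (fL _ _)) // => [v|u] k x y.
  apply: omega_inj => z; rewrite omega_sharp (linfun_val (fL _ _)).
  by lexp; rewrite !omega_sharp !(linfun_val (fL _ _)); ring.
apply: omega_inj => z; rewrite omega_sharp (linfun_val (fL _ _)).
by lexp; rewrite !omega_sharp !(linfun_val (fL _ _)); ring.
Qed.

Definition epsilon_alternating := forall L, epsilon t L L = 0.

Record Z2 : Prop := {
  Z2_alt : epsilon_alternating;
  Z2_der : forall L, derivation (xi t L);
  Z2_comm : forall L1 L2,
    (xi t L1 \o xi t L2)%VF - (xi t L2 \o xi t L1)%VF = bracket (alpha L1 L2);
  Z2_xi_alpha : forall L1 L2 L3,
    xi t L1 (alpha L2 L3) + xi t L2 (alpha L3 L1) + xi t L3 (alpha L1 L2) = 0;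
  Z2_beta_xi : forall L A1 A2,
    beta (xi t L A1) A2 + beta A1 (xi t L A2) = gamma t L (bracket A1 A2);
  Z2_gamma_xi : forall L1 L2 A,
    gamma t L2 (xi t L1 A) - gamma t L1 (xi t L2 A) + beta (alpha L1 L2) A = 0;
  Z2_gamma_alpha : forall L1 L2 L3,
    gamma t L1 (alpha L2 L3) + gamma t L2 (alpha L3 L1)
      + gamma t L3 (alpha L1 L2) = 0;
  Z2_epsilon : forall L1 L2 L3,
    epsilon t L1 L2 L3 + epsilon t L2 L3 L1 + epsilon t L3 L1 L2 = 0 }.

Definition center_part (A : a) : Prop :=
  [/\ forall B, bracket A B = 0, beta A = 0,
      forall L, xi t L A = 0 & forall L, gamma t L A = 0].

Record Z2sharp : Prop := {
  Z2sharp_Z2 :> Z2;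
  Z2sharp_a : forall L,
    (exists A : a, [/\ bracket A + xi t L = 0,
                       gamma t L + beta A = 0,
                       forall L', alpha L L' = xi t L' A
                     & forall L', epsilon t L L' = gamma t L' A]) -> L = 0;
  Z2sharp_b : forall A, center_part A ->
    (forall B, center_part B -> omega A B = 0) -> A = 0 }.

(* The underlying space of d(l, a): l^* + a + l, in this order. *)
Definition dvect : vectType R := (dual l * a * l)%type.

Definition dbracket : Lin dvect (Lin dvect dvect) :=
  bilin (fun x y : dvect =>
    let: (_, A1, L1) := x in let: (_, A2, L2) := y in
    (beta A1 A2 + gamma t L1 A2 - gamma t L2 A1 + epsilon t L1 L2,
     bracket A1 A2 + xi t L1 A2 - xi t L2 A1 + alpha L1 L2, 0) : dvect).

Definition domega : Lin dvect (dual dvect) :=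
  bilin (fun x y : dvect =>
    let: (f1, A1, L1) := x in let: (f2, A2, L2) := y in
    f1 L2 + omega A1 A2 - f2 L1 : R^o).

Lemma dvectP k (x y : dvect) :
  k *: x + y =
  (k *: x.1.1 + y.1.1, k *: x.1.2 + y.1.2, k *: x.2 + y.2) :> dvect.
Proof. by []. Qed.

Lemma dbracketE (x y : dvect) :
  dbracket x y =
  (beta x.1.2 y.1.2 + gamma t x.2 y.1.2 - gamma t y.2 x.1.2
     + epsilon t x.2 y.2,
   bracket x.1.2 y.1.2 + xi t x.2 y.1.2 - xi t y.2 x.1.2 + alpha x.2 y.2, 0).
Proof.
rewrite /dbracket bilinE => [|v k x1 x2|u k x1 x2].
- by case: x y => [[? ?] ?] [[? ?] ?].
- rewrite !dvectP; case: v x1 x2 => [[? ?] ?] [[? ?] ?] [[? ?] ?].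
  rewrite [LHS]/=; apply: triple_eq; rewrite [LHS]/= [RHS]/=.
  + by apply/lfunP => z; lexp; ring.
  + by apply: omega_inj => z; lexp; ring.
  + by rewrite scaler0 addr0.
- rewrite !dvectP; case: u x1 x2 => [[? ?] ?] [[? ?] ?] [[? ?] ?].
  rewrite [LHS]/=; apply: triple_eq; rewrite [LHS]/= [RHS]/=.
  + by apply/lfunP => z; lexp; ring.
  + by apply: omega_inj => z; lexp; ring.
  + by rewrite scaler0 addr0.
Qed.

Lemma domegaE (x y : dvect) :
  domega x y = x.1.1 y.2 + omega x.1.2 y.1.2 - y.1.1 x.2.
Proof.
rewrite /domega bilinE => [|v k x1 x2|u k x1 x2].
- by case: x y => [[? ?] ?] [[? ?] ?].
- rewrite !dvectP; case: v x1 x2 => [[? ?] ?] [[? ?] ?] [[? ?] ?].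
  by rewrite [LHS]/=; lexp; ring.
- rewrite !dvectP; case: u x1 x2 => [[? ?] ?] [[? ?] ?] [[? ?] ?].
  by rewrite [LHS]/=; lexp; ring.
Qed.

Lemma alphaC L1 L2 : alpha L1 L2 = - alpha L2 L1.
Proof. by apply: omega_inj => A; rewrite !lfunX !alphaE; ring. Qed.

Lemma betaC A1 A2 : beta A1 A2 = - beta A2 A1.
Proof.
apply/lfunP => L; rewrite lfunX !betaE (omega_skew _ A2) (omega_skew A1); ring.
Qed.

Lemma epsilonC : epsilon_alternating ->
  forall L1 L2, epsilon t L1 L2 = - epsilon t L2 L1.
Proof.
move=> alt L1 L2; apply/eqP; rewrite -addr_eq0; apply/eqP.
by have := alt (L1 + L2); rewrite !lfunX !alt add0r addr0 addrC.
Qed.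

Hypothesis tZ : Z2.

Lemma dbracketxx (x : dvect) : dbracket x x = 0.
Proof.
rewrite dbracketE bracketxx (Z2_alt tZ).
have -> : beta x.1.2 x.1.2 = 0.
  by apply/lfunP => L; rewrite betaE (omega_skew x.1.2) lfunX; ring.
have -> : alpha x.2 x.2 = 0.
  by apply: omega_inj => A; rewrite alphaE !lfunX; ring.
by rewrite !add0r !addr0 !subrr.
Qed.

Lemma beta_jacobi A1 A2 A3 :
  beta A1 (bracket A2 A3) + beta A2 (bracket A3 A1) + beta A3 (bracket A1 A2)
  = 0.
Proof.
apply/lfunP => L; rewrite !lfunX !betaE !(Z2_der tZ) !lfunX.
have c1 := omega_closed (xi t L A1) A2 A3.
have c2 := omega_closed A1 (xi t L A2) A3.
have c3 := omega_closed A1 A2 (xi t L A3).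
rewrite !(omega_skew _ (bracket _ _)); lra.
Qed.

Let br1 A1 L1 A2 L2 : dual l :=
  beta A1 A2 + gamma t L1 A2 - gamma t L2 A1 + epsilon t L1 L2.
Let br2 A1 L1 A2 L2 : a :=
  bracket A1 A2 + xi t L1 A2 - xi t L2 A1 + alpha L1 L2.

Let djacobi1 A1 A2 A3 L1 L2 L3 :
  br1 A1 L1 (br2 A2 L2 A3 L3) 0 + br1 A2 L2 (br2 A3 L3 A1 L1) 0
    + br1 A3 L3 (br2 A1 L1 A2 L2) 0 = 0.
Proof.
apply/lfunP => L; rewrite /br1 /br2; lexp.
have bj := congr1 (fun f : dual l => f L) (beta_jacobi A1 A2 A3).
have b1 := congr1 (fun f : dual l => f L) (Z2_beta_xi tZ L1 A2 A3).
have b2 := congr1 (fun f : dual l => f L) (Z2_beta_xi tZ L2 A3 A1).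
have b3 := congr1 (fun f : dual l => f L) (Z2_beta_xi tZ L3 A1 A2).
have g1 := congr1 (fun f : dual l => f L) (Z2_gamma_xi tZ L2 L3 A1).
have g2 := congr1 (fun f : dual l => f L) (Z2_gamma_xi tZ L3 L1 A2).
have g3 := congr1 (fun f : dual l => f L) (Z2_gamma_xi tZ L1 L2 A3).
have ga := congr1 (fun f : dual l => f L) (Z2_gamma_alpha tZ L1 L2 L3).
rewrite !lfunX !(betaC _ (xi _ _ _)) ?lfunX in bj b1 b2 b3 g1 g2 g3 ga.
rewrite !(betaC _ (alpha _ _)) !(betaC _ (xi _ _ _)); lexp.
lra.
Qed.

Let djacobi2 A1 A2 A3 L1 L2 L3 :
  br2 A1 L1 (br2 A2 L2 A3 L3) 0 + br2 A2 L2 (br2 A3 L3 A1 L1) 0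
    + br2 A3 L3 (br2 A1 L1 A2 L2) 0 = 0.
Proof.
have c L L' (B : a) :
    xi t L (xi t L' B) = xi t L' (xi t L B) + bracket (alpha L L') B.
  by rewrite -(Z2_comm tZ) !lfunX addrC subrK.
apply: omega_inj => A; rewrite /br2; lexp.
rewrite (c L2 L1) (c L3 L2) (c L1 L3) !(Z2_der tZ) !lfunX.
have j := congr1 (fun B => omega B A) (jacobi A1 A2 A3).
have x3 := congr1 (fun B => omega B A) (Z2_xi_alpha tZ L1 L2 L3).
rewrite !lfunX in j x3.
rewrite !(bracketC _ (xi _ _ _)) !(bracketC _ (alpha _ _)).
rewrite (alphaC L2 L1) (alphaC L3 L2) (alphaC L1 L3) !lfunX.
lra.
Qed.

Lemma djacobi (x y z : dvect) :
  dbracket x (dbracket y z) + dbracket y (dbracket z x)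
    + dbracket z (dbracket x y) = 0.
Proof.
rewrite !dbracketE; apply: triple_eq.
- exact: djacobi1.
- exact: djacobi2.
- by rewrite /= !addr0.
Qed.

Lemma domega_skew (x y : dvect) : domega x y = - domega y x.
Proof. by rewrite !domegaE (omega_skew x.1.2); ring. Qed.

Lemma domega_nondeg (x : dvect) : (forall y, domega x y = 0) -> x = 0.
Proof.
case: x => [[f A] L] h; apply: triple_eq => /=.
- apply/lfunP => M; have := h (0, 0, M).
  by rewrite domegaE /fst /snd !lfunX addr0 subr0.
- apply: omega_nondeg => B; have := h (0, B, 0).
  by rewrite domegaE /fst /snd !lfunX add0r subr0.
- have dual0 M : (forall f : dual l, f M = 0) -> M = 0.
    move=> f0.
    pose g i : dual l := linfun (coord (vbasis fullv) i : l -> R^o).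
    rewrite (coord_vbasis (memvf M)) big1 // => i _.
    by have := f0 (g i); rewrite /g lfunE /= => ->; rewrite scale0r.
  apply: dual0 => g; have := h (g, 0, 0).
  by rewrite domegaE /fst /snd !lfunX !add0r => /eqP; rewrite oppr_eq0 => /eqP.
Qed.

Lemma domega_closed (x y z : dvect) :
  domega (dbracket x y) z + domega (dbracket y z) x + domega (dbracket z x) y
  = 0.
Proof.
rewrite !dbracketE !domegaE.
case: x y z => [[f1 A1] L1] [[f2 A2] L2] [[f3 A3] L3].
rewrite /fst /snd !lfunX !alphaE !betaE.
have c := omega_closed A1 A2 A3.
have e := Z2_epsilon tZ L1 L2 L3.
rewrite !(omega_skew _ (xi t _ _)).
lra.
Qed.

(* The symplectic Lie algebra d(l, a) of the cocycle t. *)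
Definition dalg : symplLie R :=
  @SymplLie R (LieAlg dbracketxx djacobi) domega domega_skew domega_nondeg
    domega_closed.
End Cochains.

Section Action.
Variables (R : realType) (l : vectType R) (a : symplLie R).

Definition tau_star (tau : Lin l a) : Lin a (dual l) :=
  bilin (fun A L => omega (tau L) A : R^o).

Lemma tau_starE tau A L : tau_star tau A L = omega (tau L) A.
Proof. by rewrite /tau_star bilinE // => [v|u] k x y; lexp. Qed.

Definition act (t : triple l a) (tau : Lin l a) : triple l a := {|
  gamma := bilin (fun L A =>
    gamma t L A + tau_star tau (xi t L A) - tau_star tau (bracket (tau L) A)
      - beta t (tau L) A);
  epsilon := bilin (fun L1 L2 =>
    epsilon t L1 L2 + tau_star tau (alpha t L1 L2)
      - gamma t L1 (tau L2) + gamma t L2 (tau L1)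
      - tau_star tau (xi t L1 (tau L2) - xi t L2 (tau L1))
      + tau_star tau (bracket (tau L1) (tau L2))
      + beta t (tau L1) (tau L2));
  xi := bilin (fun L A => xi t L A - bracket (tau L) A) |}.

Lemma act_gammaE t tau L A :
  gamma (act t tau) L A =
  gamma t L A + tau_star tau (xi t L A) - tau_star tau (bracket (tau L) A)
    - beta t (tau L) A.
Proof.
by rewrite /= bilinE // => [v|u] k x y; apply/lfunP => z; lexp; ring.
Qed.

Lemma act_epsilonE t tau L1 L2 :
  epsilon (act t tau) L1 L2 =
  epsilon t L1 L2 + tau_star tau (alpha t L1 L2)
    - gamma t L1 (tau L2) + gamma t L2 (tau L1)
    - tau_star tau (xi t L1 (tau L2) - xi t L2 (tau L1))
    + tau_star tau (bracket (tau L1) (tau L2))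
    + beta t (tau L1) (tau L2).
Proof.
by rewrite /= bilinE // => [v|u] k x y; apply/lfunP => z; lexp; ring.
Qed.

Lemma act_xiE t tau L A : xi (act t tau) L A = xi t L A - bracket (tau L) A.
Proof.
by rewrite /= bilinE // => [v|u] k x y; apply: omega_inj => z; lexp; ring.
Qed.

(* The orbit of t. The action preserves Z2, so that for cocycles these orbits
   are the points of the cohomology space H^2. *)
Definition cclass (t : triple l a) : set (triple l a) := range (act t).

Lemma triple_ext (s t : triple l a) :
  (forall L A, gamma s L A = gamma t L A) ->
  (forall L1 L2, epsilon s L1 L2 = epsilon t L1 L2) ->
  (forall L A, xi s L A = xi t L A) -> s = t.
Proof.
case: s t => [g e x] [g' e' x'] /= eg ee ex; congr Triple;
  apply/lfunP => L; apply/lfunP => M; [exact: eg|exact: ee|exact: ex].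
Qed.

Lemma act0 t : act t 0 = t.
Proof.
apply: triple_ext => [L A|L A|L A].
- rewrite act_gammaE; apply/lfunP => M.
  by rewrite !lfunX !tau_starE !lfunX addr0 !subr0.
- rewrite act_epsilonE; apply/lfunP => M.
  by rewrite !lfunX !tau_starE !lfunX !(addr0, subr0).
- by rewrite act_xiE !lfunX subr0.
Qed.

Lemma act_betaE t tau A1 A2 :
  beta (act t tau) A1 A2 = beta t A1 A2 + tau_star tau (bracket A1 A2).
Proof.
apply/lfunP => L; rewrite !betaE lfunX betaE tau_starE !act_xiE !lfunX.
have := omega_closed (tau L) A1 A2.
rewrite (omega_skew (bracket A1 A2)) (bracketC A2) !lfunX.
rewrite (omega_skew A1 (bracket _ _)); lra.
Qed.

Lemma act_alphaE t tau L1 L2 :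
  alpha (act t tau) L1 L2 =
  alpha t L1 L2 - xi t L1 (tau L2) + xi t L2 (tau L1)
    + bracket (tau L1) (tau L2).
Proof.
apply: omega_inj => A; rewrite !lfunX !alphaE !act_gammaE !lfunX.
rewrite !tau_starE !betaE.
have := omega_closed (tau L1) (tau L2) A.
rewrite (omega_skew (bracket (tau L2) A)) (bracketC A (tau L1)) !lfunX.
rewrite (omega_skew (bracket (tau L1) A)); lra.
Qed.

Lemma actD t tau sigma : act (act t tau) sigma = act t (tau + sigma).
Proof.
apply: triple_ext => [L1 A|L1 L2|L1 A].
- rewrite !act_gammaE act_betaE act_xiE; apply/lfunP => M.
  by rewrite !lfunX !tau_starE !lfunX; ring.
- rewrite !act_epsilonE !act_gammaE act_betaE act_alphaE !act_xiE.
  apply/lfunP => M.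
  lexp; rewrite !tau_starE; lexp.
  rewrite (bracketC (sigma L1) (tau L2)) (betaC t (sigma L1) (tau L2)); lexp.
  ring.
- by rewrite !act_xiE !lfunX opprD addrA.
Qed.

Lemma cclass_eq s t : cclass s = cclass t <-> exists tau, s = act t tau.
Proof.
split => [e|[tau ->]].
  have : cclass s s by exists 0 => //; rewrite act0.
  by rewrite e => -[tau _ <-]; exists tau.
apply/seteqP; split => _ [sigma _ <-].
  by exists (tau + sigma); rewrite ?actD.
by exists (sigma - tau); rewrite ?actD // addrC subrK.
Qed.
End Action.

Section Pullback.
Variables (R : realType) (l1 l2 : vectType R) (a1 a2 : symplLie R).

Definition transpose (S : Lin l1 l2) (f : dual l2) : dual l1 := (f \o S)%VF.

(* For bijective U, [U^-1%VF] is its inverse. *)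
Definition pullback (S : Lin l1 l2) (U : Lin a2 a1) (t : triple l2 a2) :
    triple l1 a1 := {|
  gamma := bilin (fun L A => transpose S (gamma t (S L) (U^-1%VF A)));
  epsilon := bilin (fun L1 L2 => transpose S (epsilon t (S L1) (S L2)));
  xi := bilin (fun L A => U (xi t (S L) (U^-1%VF A))) |}.

Lemma pullback_gammaE S U t L A :
  gamma (pullback S U t) L A = transpose S (gamma t (S L) (U^-1%VF A)).
Proof.
by rewrite /= bilinE // => [v|u] k x y; apply/lfunP => z; rewrite /transpose;
  lexp.
Qed.

Lemma pullback_epsilonE S U t L1 L2 :
  epsilon (pullback S U t) L1 L2 = transpose S (epsilon t (S L1) (S L2)).
Proof.
by rewrite /= bilinE // => [v|u] k x y; apply/lfunP => z; rewrite /transpose;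
  lexp.
Qed.

Lemma pullback_xiE S U t L A :
  xi (pullback S U t) L A = U (xi t (S L) (U^-1%VF A)).
Proof. by rewrite /= bilinE // => [v|u] k x y; lexp. Qed.
End Pullback.

(* Main.v *)
(* The ideal l^* of d(l, a) is intrinsic: by conditions (a) and (b) it is the
   intersection of the center with its omega-orthogonal. An isomorphism phi
   therefore preserves the flag l^* < l^* + a = (l^* )^perp, so it induces
   S on l and an isomorphism U^-1 on a; writing its a-component on l as
   U^-1 tau, the l^*-component on a is forced by omega to be tau^*, and
   compatibility with the brackets is exactly (S, U)^* t2 = t1 tau. Conversely
   S, U and tau determine phi up to its l^*-component on l, which does not
   enter the brackets and can be chosen to make phi symplectic. *)
Require Import Defs.
From mathcomp Require Import all_boot all_order all_algebra.
From mathcomp Require Import classical_sets reals.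
From mathcomp Require Import ring lra.
Set Implicit Arguments.
Unset Strict Implicit.
Unset Printing Implicit Defensive.
Import GRing.Theory Num.Theory.
Local Open Scope ring_scope.

(** * Linear algebra: dual spaces and inverses of bijective maps *)

Lemma dual_separates (R : realType) (l : vectType R) (M : l) :
  (forall f : dual l, f M = 0) -> M = 0.
Proof.
move=> f0.
pose g i : dual l := linfun (coord (vbasis fullv) i : l -> R^o).
rewrite (coord_vbasis (memvf M)) big1 // => i _.
by have := f0 (g i); rewrite /g lfunE /= => ->; rewrite scale0r.
Qed.

Section InverseLfun.
Variables (R : realType) (U V : vectType R) (f : Lin U V).
Hypothesis f_bij : bijective f.

Lemma bij_lfunK : cancel f (f^-1)%VF.
Proof. by apply: lker0_lfunK; apply/lker0P; exact: bij_inj. Qed.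

Lemma bij_lfunVK : cancel (f^-1)%VF f.
Proof. by move=> y; have [g _ gK] := f_bij; rewrite -[y]gK bij_lfunK. Qed.
End InverseLfun.

(** * Isomorphism invariants of a symplectic Lie algebra *)

Definition central (R : realType) (g : symplLie R) (x : g) :=
  forall y, bracket x y = 0.
(** The radical of [omega] restricted to the center. *)
Definition central_radical (R : realType) (g : symplLie R) (x : g) :=
  central x /\ forall y, central y -> omega x y = 0.

Lemma sympl_iso_inv (R : realType) (g h : symplLie R) (phi : Lin g h) :
  sympl_iso phi -> sympl_iso ((phi^-1)%VF : Lin h g).
Proof.
move=> [bij br om]; have K := bij_lfunK bij; have VK := bij_lfunVK bij.
split=> [|x y|x y]; first by exists phi.
  by apply: (bij_inj bij); rewrite br !VK.
by rewrite -om !VK.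
Qed.

Lemma central_iso (R : realType) (g h : symplLie R) (phi : Lin g h) x :
  sympl_iso phi -> central x -> central (phi x).
Proof.
move=> phi_iso cx y; have [bij br _] := phi_iso.
by rewrite -(bij_lfunVK bij y) -br cx lfun0.
Qed.

Lemma central_radical_iso (R : realType) (g h : symplLie R) (phi : Lin g h) x :
  sympl_iso phi -> central_radical x -> central_radical (phi x).
Proof.
move=> phi_iso [cx rx]; split=> [|y cy]; first exact: central_iso.
have [bij _ om] := phi_iso.
rewrite -(bij_lfunVK bij y) om rx //.
by apply: (central_iso (sympl_iso_inv phi_iso)).
Qed.

(** * The action of [tau] as a change of brackets *)

Section Twist.
Variables (R : realType) (l : vectType R) (a : symplLie R).
Variables (t s : triple l a) (tau : Lin l a).

(** The [l^*]-component may be set to 0 since [dbracket] ignores it. *)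
Definition twist (x : dvect l a) : dvect l a := (0, x.1.2 + tau x.2, x.2).

(** Brackets have no [l]-component, so the right-hand side says that [(f, A, L) |-> (f + tau_star
    tau A, A + tau L, L)] carries [dbracket t] to [dbracket s]. *)
Lemma act_eqP : s = act t tau <->
  forall x y : dvect l a,
    (dbracket t x y).1.1 + tau_star tau (dbracket t x y).1.2
      = (dbracket s (twist x) (twist y)).1.1 /\
    (dbracket t x y).1.2 = (dbracket s (twist x) (twist y)).1.2.
Proof.
split=> [-> [[f1 A1] L1] [[f2 A2] L2]|h].
  rewrite !dbracketE /twist /fst /snd; split; last first.
    rewrite act_alphaE !act_xiE !lfunX (bracketC (tau L2) A1).
    rewrite (bracketC (tau L2) (tau L1)).
    apply: omega_inj => z; lexp; ring.
  rewrite !act_gammaE act_betaE act_epsilonE; apply/lfunP => M; lexp.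
  rewrite !tau_starE !(bracketC (tau L2)) !(betaC t (tau L2)); lexp.
  ring.
(* The components are recovered in order: brackets of [l] with [a] give [xi], which determines
   [beta]; then [gamma]; finally brackets inside [l] give [epsilon]. *)
have xiE L A : xi s L A = xi t L A - bracket (tau L) A.
  have [_] := h (0, 0, L) (0, A, 0); rewrite !dbracketE /twist /fst /snd.
  rewrite !lfunX !(add0r, addr0, subr0) => ->.
  by rewrite addrAC subrr add0r.
have bE A1 A2 : beta s A1 A2 = beta (act t tau) A1 A2.
  by apply/lfunP => L; rewrite !betaE !xiE !act_xiE.
have gE L A : gamma s L A = gamma (act t tau) L A.
  have [+ _] := h (0, 0, L) (0, A, 0); rewrite !dbracketE /twist /fst /snd.
  rewrite !lfunX !(add0r, addr0, subr0) bE act_betaE => e.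
  apply/lfunP=> M; move/(congr1 (fun f : dual l => f M)): e.
  by rewrite act_gammaE !lfunX => e; lra.
apply: triple_ext => [//|L1 L2|L A]; last by rewrite xiE act_xiE.
have [+ _] := h (0, 0, L1) (0, 0, L2); rewrite !dbracketE /twist /fst /snd.
rewrite !lfunX !(add0r, addr0, subr0) bE act_betaE !gE !act_gammaE => e.
apply/lfunP=> M; move/(congr1 (fun f : dual l => f M)): e.
rewrite act_epsilonE (bracketC (tau L2)) (betaC t (tau L2)) !lfunX => e; lra.
Qed.
End Twist.

(** * Brackets of a pulled back triple *)

Section PullbackBracket.
Variables (R : realType) (l1 l2 : vectType R) (a1 a2 : symplLie R).
Variables (S : Lin l1 l2) (U : Lin a2 a1) (t : triple l2 a2).
Hypothesis U_iso : sympl_iso U.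
Let V : Lin a1 a2 := (U^-1)%VF.

(** [beta] and [alpha] are obtained from [xi] and [gamma] through [omega], so they are transported
    because [U] preserves the forms. *)
Lemma pullback_betaE A1 A2 :
  beta (pullback S U t) A1 A2 = transpose S (beta t (V A1) (V A2)).
Proof.
have [bij _ om] := U_iso; have VK := bij_lfunVK bij.
apply/lfunP => L; rewrite /transpose comp_lfunE !betaE !pullback_xiE.
by rewrite -{1}(VK A2) -{2}(VK A1) !om.
Qed.

Lemma pullback_alphaE L1 L2 :
  alpha (pullback S U t) L1 L2 = U (alpha t (S L1) (S L2)).
Proof.
have [bij _ om] := U_iso; have VK := bij_lfunVK bij.
apply: omega_inj => A; rewrite -{2}(VK A) om !alphaE !pullback_gammaE.
by rewrite /transpose !comp_lfunE.
Qed.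

(** The [l^*]-components of [x'] and [y'] are left free, so that these can later be images under a
    map known only up to such a component. *)
Lemma pullback_dbracketE (x y : dvect l1 a1) (x' y' : dvect l2 a2) :
  x'.1.2 = V x.1.2 -> x'.2 = S x.2 -> y'.1.2 = V y.1.2 -> y'.2 = S y.2 ->
  (dbracket (pullback S U t) x y).1.1 = transpose S (dbracket t x' y').1.1 /\
  (dbracket (pullback S U t) x y).1.2 = U (dbracket t x' y').1.2.
Proof.
have [bij br om] := U_iso; have VK := bij_lfunVK bij.
rewrite !dbracketE => -> -> -> ->; rewrite /fst /snd.
rewrite pullback_betaE pullback_alphaE !pullback_gammaE pullback_epsilonE.
rewrite !pullback_xiE; split.
  by apply/lfunP=> M; rewrite /transpose !lfunX.
by rewrite !lfunX br !VK.
Qed.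
End PullbackBracket.

(** * The center of [d(l, a)] and its radical *)

Section Center.
Variables (R : realType) (l : vectType R) (a : symplLie R).
Variables (t : triple l a) (t_sharp : Z2sharp t).
Let d : symplLie R := dalg t_sharp.

(** Commuting with [a] and with [l] gives precisely the four equations of condition (a), so the
    [l]-component vanishes; for [L = 0] they reduce to [center_part]. *)
Lemma dalg_centralP (x : dvect l a) :
  central (x : d) <-> x.2 = 0 /\ center_part t x.1.2.
Proof.
split=> [c|]; last first.
  case: x => [[f A] L] /= [-> [hb hbe hx hg]] y.
  rewrite [LHS]dbracketE /fst /snd hb hbe hx hg.
  by rewrite !lfunX !subr0 !addr0.
case: x c => [[f A] L] c; rewrite /fst /snd.
have cA B : beta t A B + gamma t L B = 0 /\ bracket A B + xi t L B = 0.
  have := c (0, B, 0); rewrite [bracket _ _]dbracketE /fst /snd => e.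
  have e1 := congr1 (fun x : dvect l a => x.1.1) e.
  have e2 := congr1 (fun x : dvect l a => x.1.2) e.
  move: e1 e2; rewrite /fst /snd => e1 e2; split.
    by move: e1; rewrite !lfunX subr0 addr0.
  by move: e2; rewrite !lfunX subr0 addr0.
have cL M : epsilon t L M = gamma t M A /\ alpha t L M = xi t M A.
  have := c (0, 0, M); rewrite [bracket _ _]dbracketE /fst /snd => e.
  have e1 := congr1 (fun x : dvect l a => x.1.1) e.
  have e2 := congr1 (fun x : dvect l a => x.1.2) e.
  move: e1 e2; rewrite /fst /snd !lfunX !add0r => e1 e2.
  by split; apply/eqP; rewrite -subr_eq0 addrC; apply/eqP.
have L0 : L = 0.
  apply: (Z2sharp_a t_sharp); exists A; split=> [|| M | M].
  - by apply/lfunP=> B; rewrite add_lfunE (cA B).2 zero_lfunE.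
  - by apply/lfunP=> B; rewrite add_lfunE addrC (cA B).1 zero_lfunE.
  - exact: (cL M).2.
  - exact: (cL M).1.
rewrite {}L0 in cA cL *; split=> //; split=> [B||M|M].
- by have [_] := cA B; rewrite !lfunX addr0.
- by apply/lfunP=> B; have [] := cA B; rewrite !lfunX addr0.
- by have [_] := cL M; rewrite !lfunX => <-.
- by have [] := cL M; rewrite !lfunX => <-.
Qed.

(** The center is [l^*] plus the space of condition (b). There [l^*] pairs to zero with everything,
    as it only meets [l]-components, while [omega] is non-degenerate on the second summand. *)
Lemma dalg_central_radicalP (x : dvect l a) :
  central_radical (x : d) <-> x.1.2 = 0 /\ x.2 = 0.
Proof.
case: x => [[f A] L]; split=> [[/dalg_centralP /= [-> cA] r]|/= [-> ->]].
  split=> //; apply: (Z2sharp_b t_sharp cA) => B cB.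
  have cB' : central ((0, B, 0) : d) by apply/dalg_centralP.
  have : domega _ _ (f, A, 0) ((0, B, 0) : dvect l a) = 0 by exact: (r _ cB').
  by rewrite domegaE /fst /snd !lfunX add0r subr0.
have c0 : center_part t 0 by split=> *; rewrite ?lfunX.
split=> [|[[g B] M] /dalg_centralP /= [-> _]]; first exact/dalg_centralP.
by rewrite [LHS]domegaE /fst /snd !lfunX addr0 subr0.
Qed.
End Center.

(** * Maps between two algebras [d(l, a)] *)

Section DalgMaps.
Variables (R : realType) (l1 l2 : vectType R) (a1 a2 : symplLie R).
Variables (t1 : triple l1 a1) (t2 : triple l2 a2).
Variables (t1_sharp : Z2sharp t1) (t2_sharp : Z2sharp t2).

(* Conditions under which [phi] is determined, up to its l^*-component on l,
   by maps [S], [U] and [tau]. *)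
Definition dalg_map_shape (S : Lin l1 l2) (U : Lin a2 a1) (tau : Lin l1 a1)
    (phi : dvect l1 a1 -> dvect l2 a2) :=
  [/\ forall x, (phi x).2 = S x.2,
      forall x, (phi x).1.2 = U^-1%VF (x.1.2 + tau x.2)
    & forall x, x.2 = 0 ->
        transpose S (phi x).1.1 = x.1.1 + tau_star tau x.1.2].

(** Up to the free component, [phi] is [twist tau] followed by transport along [S] and [U]. Brackets
    lie in [l^* + a], where [phi] is fully determined, so [act_eqP] and [pullback_dbracketE]
    combine. *)
Lemma dalg_map_shape_hom (S : Lin l1 l2) (U : Lin a2 a1) tau phi :
  bijective S -> sympl_iso U -> dalg_map_shape S U tau phi ->
  (forall x y, phi (dbracket t1 x y) = dbracket t2 (phi x) (phi y)) <->
  pullback S U t2 = act t1 tau.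
Proof.
move=> Sbij U_iso [p3 p2 p1]; have [Ubij _ _] := U_iso.
have VK := bij_lfunVK Ubij; have K := bij_lfunK Ubij.
have d0 x y : (dbracket t1 x y).2 = 0 by rewrite dbracketE.
have d0' x y : (dbracket t2 x y).2 = 0 by rewrite dbracketE.
have E x y := @pullback_dbracketE _ _ _ _ _ S _ t2 U_iso (twist tau x)
  (twist tau y) (phi x) (phi y) (p2 x) (p3 x) (p2 y) (p3 y).
split=> [h|/act_eqP h x y].
  apply/act_eqP => x y; have [-> ->] := E x y.
  by rewrite -h p2 d0 lfun0 addr0 VK p1.
have [e1 e2] := E x y; have [h1 h2] := h x y.
apply: triple_eq.
(* Surjectivity of [S] makes [transpose S] injective, so the forms are compared on vectors in the
   image of [S]. *)
- apply/lfunP => M2; rewrite -(bij_lfunVK Sbij M2).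
  move: (congr1 (fun f : dual l1 => f (S^-1%VF M2)) (p1 _ (d0 x y))).
  by rewrite h1 e1 /transpose !comp_lfunE.
- by rewrite p2 d0 lfun0 addr0 h2 e2 K.
- by rewrite p3 d0 d0' lfun0.
Qed.

(** Shifting [l] by [tau] adds [omega (tau L1) (tau L2)] to the form on [l]. As this is skew, a
    correction by half of it in the [l^*]-component, which enters once from each argument, cancels
    it. *)
Lemma dalg_map_shape_exists (S : Lin l1 l2) (U : Lin a2 a1) tau :
  bijective S -> sympl_iso U ->
  exists phi : Lin (dvect l1 a1) (dvect l2 a2),
    [/\ bijective phi, forall x y, domega _ _ (phi x) (phi y) = domega _ _ x y
      & dalg_map_shape S U tau phi].
Proof.
move=> Sbij U_iso; have [Ubij _ _] := U_iso.
have [_ _ Vom] := sympl_iso_inv U_iso.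
have SK := bij_lfunK Sbij; have SVK := bij_lfunVK Sbij.
pose V : Lin a1 a2 := (U^-1)%VF; pose T : Lin l2 l1 := (S^-1)%VF.
(* The term in [x.2] makes the images of l isotropic again. *)
pose F (x : dvect l1 a1) : dvect l2 a2 :=
  (transpose T (x.1.1 + tau_star tau x.1.2
     - 2^-1 *: ((omega (tau x.2) : dual a1) \o tau)%VF),
   V (x.1.2 + tau x.2), S x.2).
have F1 x L : (F x).1.1 (S L) =
    x.1.1 L + omega (tau L) x.1.2 - 2^-1 * omega (tau x.2) (tau L).
  by rewrite /F /transpose /fst /T; lexp; rewrite SK tau_starE.
have F2 x : (F x).1.2 = V (x.1.2 + tau x.2) by [].
have F3 x : (F x).2 = S x.2 by [].
clearbody F.
have Flin : linear F.
  move=> k x y; rewrite !dvectP; apply: triple_eq => /=.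
  - apply/lfunP => M; rewrite -(SVK M) F1 /=; lexp; rewrite !F1; lexp; ring.
  - by rewrite !F2 /=; apply: omega_inj => z; lexp; ring.
  - by rewrite !F3 /=; lexp.
pose phi : Lin (dvect l1 a1) (dvect l2 a2) := linfun F.
have phiE x : phi x = F x by exact: linfun_val.
have phi_om x y : domega _ _ (phi x) (phi y) = domega _ _ x y.
  rewrite !phiE !domegaE !F3 !F1 !F2 Vom; lexp.
  rewrite (omega_skew (tau x.2) y.1.2) (omega_skew (tau y.2) (tau x.2)).
  rewrite (omega_skew x.1.2 (tau y.2)) (omega_skew y.1.2 (tau x.2)).
  move: x y => [[f1 A1] L1] [[f2 A2] L2]; rewrite /fst /snd.
  lra.
exists phi; split=> //; last first.
  split=> [x|x|x x0]; rewrite phiE ?F2 ?F3 //.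
  apply/lfunP => M; rewrite /transpose comp_lfunE F1 x0 !lfunX mulr0 subr0.
  by rewrite tau_starE.
(* A map preserving a non-degenerate form is injective, so a right inverse suffices for
   bijectivity. *)
have phi_inj : injective phi.
  move=> x y exy; apply/eqP; rewrite -subr_eq0; apply/eqP.
  apply: (@domega_nondeg _ _ a1) => z.
  by rewrite -phi_om lfunD lfunN exy subrr !lfunX.
(* [F] is block triangular: it is inverted first on [l], then on [a], then on [l^*]. *)
pose G (y : dvect l2 a2) : dvect l1 a1 :=
  let L := T y.2 in let A := U y.1.2 - tau L in
  (transpose S y.1.1 - tau_star tau A
     + 2^-1 *: ((omega (tau L) : dual a1) \o tau)%VF, A, L).
have GK : cancel G phi.
  move=> y; rewrite phiE; apply: triple_eq.
  - apply/lfunP => M; rewrite -(SVK M) F1 /G /fst /snd /transpose; lexp.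
    by rewrite !tau_starE; ring.
  - by rewrite F2 /G /= subrK (bij_lfunK Ubij).
  - by rewrite F3 /G /= SVK.
by exists G => // x; apply: phi_inj; rewrite GK.
Qed.

Lemma dalg_iso_shape (phi : Lin (dvect l1 a1) (dvect l2 a2)) :
  sympl_iso (phi : Lin (dalg t1_sharp) (dalg t2_sharp)) ->
  exists (S : Lin l1 l2) (U : Lin a2 a1) (tau : Lin l1 a1),
    [/\ bijective S, sympl_iso U & dalg_map_shape S U tau phi].
Proof.
move=> phi_iso; have [phi_bij br om] := phi_iso.
pose psi : Lin (dvect l2 a2) (dvect l1 a1) := (phi^-1)%VF.
have psi_iso : sympl_iso (psi : Lin (dalg t2_sharp) (dalg t1_sharp)).
  exact: sympl_iso_inv.
have phiK : cancel psi phi by exact: bij_lfunVK.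
have phi_om (x y : dvect l1 a1) : domega _ _ (phi x) (phi y) = domega _ _ x y.
  exact: om.
have phi_br (x y : dvect l1 a1) :
    phi (dbracket t1 x y) = dbracket t2 (phi x) (phi y).
  exact: br.
(* [l^*] is the central radical on both sides, hence preserved. *)
have phiZ f : (phi (f, 0, 0)).1.2 = 0 /\ (phi (f, 0, 0)).2 = 0.
  apply/(dalg_central_radicalP t2_sharp).
  by apply: (central_radical_iso phi_iso); apply/dalg_central_radicalP.
(* [l^* + a] is orthogonal to [l^*], and [psi] maps [l^*] into [l^*]; hence [phi] of it is
   orthogonal to every [g] in the dual of [l2]. *)
have phiA f A : (phi (f, A, 0)).2 = 0.
  apply: dual_separates => g; set x := (f, A, 0).
  have [g2 g3] : (psi (g, 0, 0)).1.2 = 0 /\ (psi (g, 0, 0)).2 = 0.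
    apply/(dalg_central_radicalP t1_sharp).
    by apply: (central_radical_iso psi_iso); apply/dalg_central_radicalP.
  have : domega _ _ (phi x) (g, 0, 0) = 0.
    rewrite -[(g, 0, 0)]phiK phi_om domegaE g2 g3 /x /fst /snd.
    by rewrite !lfunX addr0 subr0.
  rewrite domegaE /= !lfunX !add0r => /eqP; rewrite oppr_eq0; exact/eqP.
have inL_lin : linear (fun L : l1 => (0, 0, L) : dvect l1 a1).
  by move=> k x y; rewrite dvectP /= !scaler0 !addr0.
have inA_lin : linear (fun A : a1 => (0, A, 0) : dvect l1 a1).
  by move=> k x y; rewrite dvectP /= !scaler0 !addr0.
have pL_lin : linear (fun x : dvect l2 a2 => x.2) by [].
have pA_lin : linear (fun x : dvect l2 a2 => x.1.2) by [].
pose inL : Lin l1 (dvect l1 a1) := linfun (fun L => (0, 0, L)).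
pose inA : Lin a1 (dvect l1 a1) := linfun (fun A => (0, A, 0)).
pose pL : Lin (dvect l2 a2) l2 := linfun (fun x => x.2).
pose pA : Lin (dvect l2 a2) a2 := linfun (fun x => x.1.2).
pose S : Lin l1 l2 := (pL \o phi \o inL)%VF.
pose V : Lin a1 a2 := (pA \o phi \o inA)%VF.
pose rho : Lin l1 a2 := (pA \o phi \o inL)%VF.
have SE L : S L = (phi (0, 0, L)).2.
  by rewrite /S !comp_lfunE (linfun_val pL_lin) (linfun_val inL_lin).
have VE A : V A = (phi (0, A, 0)).1.2.
  by rewrite /V !comp_lfunE (linfun_val pA_lin) (linfun_val inA_lin).
have rhoE L : rho L = (phi (0, 0, L)).1.2.
  by rewrite /rho !comp_lfunE (linfun_val pA_lin) (linfun_val inL_lin).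
have xE (x : dvect l1 a1) : x = (x.1.1, x.1.2, 0) + (0, 0, x.2).
  by apply: triple_eq; rewrite /= ?addr0 ?add0r.
have xE' f A : (f, A, 0) = (f, 0, 0) + (0, A, 0) :> dvect l1 a1.
  by apply: triple_eq; rewrite /= ?addr0 ?add0r.
have p3 x : (phi x).2 = S x.2.
  by rewrite {1}[x]xE lfunD SE /= phiA add0r.
have p2 x : (phi x).1.2 = V x.1.2 + rho x.2.
  by rewrite {1}[x]xE xE' !lfunD VE rhoE /= (phiZ _).1 add0r.
(* Injectivity comes from the preserved pairing of [l^*] with [l], surjectivity from that of
   [phi]. *)
have Sbij : bijective S.
  have Sinj : injective S.
    move=> L M e; apply/eqP; rewrite -subr_eq0; apply/eqP.
    have : S (L - M) = 0 by rewrite lfunD lfunN e subrr.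
    move: {L M e} (L - M) => L e; apply: dual_separates => f.
    have := phi_om (f, 0, 0) (0, 0, L).
    rewrite !domegaE !p3 (phiZ f).1 /= !e !lfunX !addr0 !subr0.
    by move=> ->.
  have SK : cancel (fun M => (psi (0, 0, M)).2) S.
    by move=> M; rewrite -p3 phiK.
  by exists (fun M => (psi (0, 0, M)).2) => // L; apply: Sinj; rewrite SK.
have V_om A B : omega (V A) (V B) = omega A B.
  have := phi_om (0, A, 0) (0, B, 0).
  by rewrite !domegaE !p2 !p3 /= !lfunX !addr0 !add0r !subr0.
have Vbij : bijective V.
  have Vinj : injective V.
    by move=> A B e; apply: omega_inj => C; rewrite -V_om e V_om.
  have VK : cancel (fun B => (psi (0, B, 0)).1.2) V.
    move=> B; have := p2 (psi (0, B, 0)); rewrite phiK.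
    suff -> : (psi (0, B, 0)).2 = 0 by rewrite lfun0 addr0.
    by apply: (bij_inj Sbij); rewrite -p3 phiK lfun0.
  by exists (fun B => (psi (0, B, 0)).1.2) => // A; apply: Vinj; rewrite VK.
have V_iso : sympl_iso V.
  split=> // A B; have := phi_br (0, A, 0) (0, B, 0).
  rewrite !dbracketE => /(congr1 (fun x : dvect l2 a2 => x.1.2)).
  by rewrite p2 /= !p2 !p3 /= !lfunX !addr0 !subr0.
pose U : Lin a2 a1 := (V^-1)%VF; have U_iso : sympl_iso U.
  exact: sympl_iso_inv.
have [Ubij _ _] := U_iso.
have UVE A : U^-1%VF A = V A.
  by apply: (bij_inj Ubij); rewrite (bij_lfunVK Ubij) (bij_lfunK Vbij).
have URK L : V (U (rho L)) = rho L by exact: bij_lfunVK.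
(* With [tau = U rho] and [V] the inverse of [U], [V (A + tau L) = V A + rho L]. *)
exists S, U, (U \o rho)%VF; split=> //; split=> // [x|x x0].
  by rewrite UVE lfunD comp_lfunE URK p2.
apply/lfunP => M; rewrite [LHS]comp_lfunE add_lfunE tau_starE.
rewrite [(U \o rho)%VF M]comp_lfunE.
rewrite -V_om URK.
(* Pairing with the image of [l] forces the [l^*]-component on [l^* + a]; the term
   [omega (rho M) (V A)] becomes [tau_star] because [V] preserves [omega]. *)
have := phi_om x (0, 0, M).
rewrite !domegaE !p2 !p3 x0 /= !lfun0 !addr0 !add0r !subr0.
by rewrite (omega_skew (V _)) => /eqP; rewrite subr_eq => /eqP.
Qed.
End DalgMaps.

Theorem theorem6 (R : realType) (l1 l2 : lieAlg R)
    (l1_abelian : lie_abelian l1) (l2_abelian : lie_abelian l2)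
    (a1 a2 : symplLie R) (t1 : triple l1 a1) (t2 : triple l2 a2)
    (t1_sharp : Z2sharp t1) (t2_sharp : Z2sharp t2) :
  sympl_isomorphic (dalg t1_sharp) (dalg t2_sharp) <->
  exists (S : Lin l1 l2) (U : Lin a2 a1),
    [/\ bijective S, sympl_iso U & cclass (pullback S U t2) = cclass t1].
Proof.
split=> [[phi phi_iso]|[S [U [Sbij U_iso /cclass_eq [tau e]]]]].
  have [S [U [tau [Sbij U_iso shape]]]] := dalg_iso_shape phi_iso.
  exists S, U; split=> //; apply/cclass_eq; exists tau.
  apply/(dalg_map_shape_hom t1 t2 Sbij U_iso shape) => x y.
  by have [_ br _] := phi_iso; exact: br.
have [phi [bij om shape]] := dalg_map_shape_exists tau Sbij U_iso.
exists phi; split=> //.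
exact/(dalg_map_shape_hom t1 t2 Sbij U_iso shape).
Qed.
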